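(* Consider two sibling nodes at depth $\rho$ of the OPM search tree whose partial mappings $f_\rho$ and $f_\rho'$ differ only in the assignment of piece $j_\rho$, with $f_\rho(j_\rho) = i$ and $f_\rho'(j_\rho) = i'$ for $i < i'$. Suppose that $f_\rho(j_k) = f_\rho'(j_k)$ for all previously assigned pieces $j_k$, $k < \rho$. Consider the two child nodes $f_{\rho+1}$ and $f_{\rho+1}'$ obtained by extending $f_\rho$ and $f_\rho'$, respectively, by assigning piece $j_{\rho+1}$ to bin $i'$, with all other assignments unchanged. If $f_{\rho+1}$ is infeasible at bin $i'$, then $f_{\rho+1}'$ is also infeasible.
   Context: **Tree.** $\mathcal J=(j_1,\dots,j_{|\mathcal J|})$ is a sequence of pieces and $\mathcal I=(i_1,\dots,i_{|\mathcal I|})$ a sequence of bins, both ordered by the same rule (both reverse pickup order, or both delivery order); $i<i'$ means that bin $i$ precedes bin $i'$ in the sequence. The OPM search tree is the rooted tree whose nodes at depth $\rho$ are the non-decreasing maps $f_\rho:\{j_1,\dots,j_\rho\}\to\mathcal I$ (partial order-preserving mappings), the root being the empty map and the children of $f_\rho$ being obtained by assigning $j_{\rho+1}$ to a bin not smaller than $f_\rho(j_\rho)$ (any bin if $\rho=0$). Sibling nodes are nodes with the same parent. **Bins and feasibility.** Each bin is a rectangle (the rectangle occupied by an item in a verified feasible packing plan), and each piece is a rectangle with positive side lengths. Each piece has a pickup rank and a delivery rank. A partial mapping is feasible at a bin if the set of pieces it assigns to that bin can be packed in the bin under the packing constraints: each piece $j$ gets a bottom-left corner $(x_j,y_j)$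 and an orientation (possibly rotated by $90^\circ$) with effective width $\bar w_j$ and length $\bar l_j$ such that (a) each piece lies inside the bin; (b) any two distinct pieces $j,j'$ satisfy $x_j+\bar w_j\le x_{j'}$, $x_{j'}+\bar w_{j'}\le x_j$, $y_j+\bar l_j\le y_{j'}$ or $y_{j'}+\bar l_{j'}\le y_j$; (c) whenever $j$ is picked up later than $j'$, or delivered earlier than $j'$, one has $x_j+\bar w_j\le x_{j'}$, $x_{j'}+\bar w_{j'}\le x_j$ or $y_j\ge y_{j'}+\bar l_{j'}$; (d) pieces with prescribed (inherited) placements, if any, are at those placements. Otherwise it is infeasible at that bin. A node is infeasible if its partial mapping is infeasible at some bin. *)

(* Defs.v *)
From mathcomp Require Import all_boot all_order all_algebra.
From mathcomp Require Import reals.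

Set Implicit Arguments.
Unset Strict Implicit.
Unset Printing Implicit Defensive.

Import Order.TTheory GRing.Theory Num.Theory.
Local Open Scope ring_scope.

(* Positions in the pickup sequence and in the delivery sequence; a larger rank
   means later. Ties are allowed. *)
Record ranks := Ranks { pickup : nat; delivery : nat }.

(* Bottom-left corner, and whether the piece is rotated by 90 degrees. *)
Record placement (R : realType) := Placement {
  corner_x : R;
  corner_y : R;
  rotated : bool }.

(* [prescribed] is the inherited placement of the piece, if there is one. *)
Record piece (R : realType) := Piece {
  piece_width : R;
  piece_length : R;
  piece_ranks : ranks;
  prescribed : option (placement R);
  piece_width_gt0 : 0 < piece_width;
  piece_length_gt0 : 0 < piece_length }.

(* A bin is the rectangle
   [bin_x, bin_x + bin_width] x [bin_y, bin_y + bin_length]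
   occupied by an item; [bin_ranks] are the ranks of that item. *)
Record bin (R : realType) := Bin {
  bin_x : R;
  bin_y : R;
  bin_width : R;
  bin_length : R;
  bin_ranks : ranks;
  bin_width_gt0 : 0 < bin_width;
  bin_length_gt0 : 0 < bin_length }.

Inductive order_rule := ReversePickup | Delivery.

Definition precedes (r : order_rule) : rel ranks := fun a b =>
  match r with
  | ReversePickup => (pickup b <= pickup a)%N
  | Delivery => (delivery a <= delivery b)%N
  end.

Definition pieces_ordered (R : realType) (m : nat) (r : order_rule)
    (J : m.-tuple (piece R)) : bool :=
  sorted (relpre (@piece_ranks R) (precedes r)) J.

Definition bins_ordered (R : realType) (n : nat) (r : order_rule)
    (I : n.-tuple (bin R)) : bool :=
  sorted (relpre (@bin_ranks R) (precedes r)) I.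

(* Pieces and bins are referred to by their (0-based) index in their sequence,
   so the order on bins is the order of 'I_n, and equal entries of a sequence
   at different indices are distinct pieces or bins. [None] means that the
   piece is not assigned yet. *)
Definition partial_map (m n : nat) := {ffun 'I_m -> option 'I_n}.

(* The domain {j_1, ..., j_rho} is the set of indices k < rho. *)
Definition is_node (m n rho : nat) (f : partial_map m n) : Prop :=
  [/\ (rho <= m)%N,
      forall k : 'I_m, isSome (f k) = (k < rho)%N
    & forall (k l : 'I_m) (a b : 'I_n),
        (k <= l)%N -> f k = Some a -> f l = Some b -> (a <= b)%N].

Definition assign (m n : nat) (f : partial_map m n) (j : 'I_m) (b : 'I_n) :
    partial_map m n :=
  [ffun k => if k == j then Some b else f k].

(* With 0-based indices, j is the first unassigned piece of the depth-rho node
   f when j = rho, and the last assigned piece, if any, is the k with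
   k + 1 = rho. *)
Definition is_child (m n : nat) (f g : partial_map m n) : Prop :=
  exists (rho : nat) (j : 'I_m) (b : 'I_n),
    [/\ is_node rho f,
        j = rho :> nat,
        forall (k : 'I_m) (a : 'I_n), k.+1 = rho -> f k = Some a -> (a <= b)%N
      & g = assign f j b].

Definition siblings (m n : nat) (f f' : partial_map m n) : Prop :=
  exists p : partial_map m n, is_child p f /\ is_child p f'.

Definition eff_width (R : realType) (p : piece R) (q : placement R) : R :=
  if rotated q then piece_length p else piece_width p.

Definition eff_length (R : realType) (p : piece R) (q : placement R) : R :=
  if rotated q then piece_width p else piece_length p.

Definition inside (R : realType) (p : piece R) (q : placement R) (b : bin R) :
    Prop :=
  [/\ bin_x b <= corner_x q,
      corner_x q + eff_width p q <= bin_x b + bin_width b,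
      bin_y b <= corner_y q
    & corner_y q + eff_length p q <= bin_y b + bin_length b].

Definition x_separated (R : realType) (p p' : piece R) (q q' : placement R) :
    Prop :=
  corner_x q + eff_width p q <= corner_x q' \/
  corner_x q' + eff_width p' q' <= corner_x q.

Definition no_overlap (R : realType) (p p' : piece R) (q q' : placement R) :
    Prop :=
  x_separated p p' q q' \/
  (corner_y q + eff_length p q <= corner_y q' \/
   corner_y q' + eff_length p' q' <= corner_y q).

Definition unobstructed (R : realType) (p p' : piece R) (q q' : placement R) :
    Prop :=
  x_separated p p' q q' \/ corner_y q' + eff_length p' q' <= corner_y q.

Definition later_pickup_or_earlier_delivery (a b : ranks) : Prop :=
  (pickup b < pickup a)%N \/ (delivery a < delivery b)%N.

(* The values of P outside S are irrelevant. *)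
Definition can_pack (R : realType) (m : nat) (J : m.-tuple (piece R))
    (b : bin R) (S : {set 'I_m}) : Prop :=
  exists P : 'I_m -> placement R,
    [/\ forall j, j \in S -> inside (tnth J j) (P j) b,
        forall j j', j \in S -> j' \in S -> j != j' ->
          no_overlap (tnth J j) (tnth J j') (P j) (P j'),
        forall j j', j \in S -> j' \in S ->
          later_pickup_or_earlier_delivery
            (piece_ranks (tnth J j)) (piece_ranks (tnth J j')) ->
          unobstructed (tnth J j) (tnth J j') (P j) (P j')
      & forall j q, j \in S -> prescribed (tnth J j) = Some q -> P j = q].

Definition pieces_at (m n : nat) (f : partial_map m n) (i : 'I_n) :
    {set 'I_m} :=
  [set j | f j == Some i].

Definition infeasible_at (R : realType) (m n : nat) (J : m.-tuple (piece R))
    (I : n.-tuple (bin R)) (f : partial_map m n) (i : 'I_n) : Prop :=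
  ~ can_pack J (tnth I i) (pieces_at f i).

Definition infeasible (R : realType) (m n : nat) (J : m.-tuple (piece R))
    (I : n.-tuple (bin R)) (f : partial_map m n) : Prop :=
  exists i : 'I_n, infeasible_at J I f i.

(* Main.v *)
Require Import Defs.
From mathcomp Require Import all_boot all_order all_algebra.
From mathcomp Require Import reals.

(** Feasibility of a bin is hereditary: a packing of a set of pieces restricts to
    a packing of every subset, because each packing constraint only speaks of
    one or two of the packed pieces ([can_packS]).  Moving the last assigned
    piece of [f] from [i] to [i'] takes nothing away from [i'] and adds that
    piece to it, and giving the next piece to [i'] enlarges both loads of [i']
    by the same piece.  So the load of [i'] under [g] is contained in its load
    under [g'], and a packing for [g'] would yield one for [g]: the bin [i']
    itself witnesses that [g'] is infeasible. *)

Lemma can_packS (R : realType) (m : nat) (J : m.-tuple (piece R)) (b : bin R)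
    (S T : {set 'I_m}) :
  S \subset T -> can_pack J b T -> can_pack J b S.
Proof.
move=> /subsetP sST [P [Pin Pdisj Punob Ppresc]].
exists P; split=> [j /sST|j j' /sST jT /sST|j j' /sST jT /sST|j q /sST].
- exact: Pin.
- exact: Pdisj.
- exact: Punob.
- exact: Ppresc.
Qed.

Lemma pieces_at_assign (m n : nat) (f : partial_map m n) (j : 'I_m)
    (b : 'I_n) :
  pieces_at (assign f j b) b = j |: pieces_at f b.
Proof.
by apply/setP=> k; rewrite !inE ffunE; case: (k == j); rewrite ?eqxx.
Qed.

Theorem proposition6 (R : realType) (m n : nat)
    (J : m.-tuple (piece R)) (I : n.-tuple (bin R)) (r : order_rule)
    (hJ : pieces_ordered r J) (hI : bins_ordered r I)
    (rho : nat) (f f' : partial_map m n)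
    (hf : is_node rho f) (hf' : is_node rho f') (hsib : siblings f f')
    (* j_rho and j_(rho+1) have 0-based indices rho - 1 and rho *)
    (j j1 : 'I_m) (hj : j.+1 = rho) (hj1 : nat_of_ord j1 = rho)
    (i i' : 'I_n) (hii' : (i < i')%N)
    (hfj : f j = Some i) (hfj' : f' j = Some i')
    (hprev : forall k : 'I_m, (k < j)%N -> f k = f' k)
    (g g' : partial_map m n)
    (hg : is_child f g) (hgE : g = assign f j1 i')
    (hg' : is_child f' g') (hgE' : g' = assign f' j1 i')
    (hinf : infeasible_at J I g i') :
  infeasible J I g'.
Proof.
suff sub : pieces_at f i' \subset pieces_at f' i'.
  exists i' => packg'; apply: hinf; apply: can_packS packg'.
  by rewrite hgE hgE' !pieces_at_assign setUS.
apply/subsetP=> k; rewrite !inE => /eqP fk.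
case: (ltngtP k j) => [ltkj | ltjk | /val_inj eqkj].
- by rewrite -hprev // fk.
- (* beyond j nothing is assigned yet *)
  by case: hf => _ /(_ k); rewrite fk /= -hj ltnS leqNgt ltjk.
- by rewrite eqkj hfj'.
Qed.
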